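(* Let $f$ be a partial function and $\epsilon\ge0$. Then there exists a distribution $\mu$ over $\mathrm{Dom}(f)$ such that every randomized algorithm $A$ that computes $f$ with error at most $\epsilon$ on all $x\in\mathrm{Dom}(f)$ satisfies $\mathbb{E}_{x\sim\mu}A(x)\ge\bar{\mathrm{R}}_\epsilon(f)$, where $A(x)$ is the expected number of queries made by $A$ on $x$.
   Context: $f$ is a function defined on a subset $\mathrm{Dom}(f)$ of $\{0,1\}^n$. A randomized query algorithm is a probability distribution over deterministic decision trees; it computes $f$ with error at most $\epsilon$ if on every $x\in\mathrm{Dom}(f)$ it outputs $f(x)$ with probability at least $1-\epsilon$. $\bar{\mathrm{R}}_\epsilon(f)$ is the minimum, over such algorithms, of the maximum over $x\in\mathrm{Dom}(f)$ of the expected number of queries. *)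

(* Defs.v *)
From HB Require Import structures.
From mathcomp Require Import all_boot all_order all_algebra.
From mathcomp Require Import all_classical all_reals all_analysis.

Set Implicit Arguments.
Unset Strict Implicit.
Unset Printing Implicit Defensive.

Import Order.TTheory GRing.Theory Num.Theory.

Local Open Scope classical_set_scope.
Local Open Scope ring_scope.

(* A partial function on {0,1}^n with values in O is a total function into
   [option O]; its domain is the set of inputs not sent to [None]. *)
Definition Dom (n : nat) (O : Type) (f : n.-tuple bool -> option O) :
  {pred n.-tuple bool} := [pred x | isSome (f x)].

(* A branch may query the same bit again; the repetition is then counted. *)
Inductive dtree (n : nat) (O : Type) : Type :=
| Leaf of O
| Query of 'I_n & dtree n O & dtree n O.

Arguments Leaf {n O} _.
Arguments Query {n O} _ _ _.

(* [Query i t0 t1] continues with [t0] if bit i is 0 and with [t1] if it is 1. *)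
Fixpoint output (n : nat) (O : Type) (t : dtree n O) (x : n.-tuple bool) : O :=
  match t with
  | Leaf o => o
  | Query i t0 t1 => if tnth x i then output t1 x else output t0 x
  end.

Fixpoint nqueries (n : nat) (O : Type) (t : dtree n O) (x : n.-tuple bool)
    : nat :=
  match t with
  | Leaf _ => 0
  | Query i t0 t1 => (if tnth x i then nqueries t1 x else nqueries t0 x).+1
  end.

(* Decision trees carry the discrete sigma-algebra, in which every set of trees
   is an event. The library's measurable types are pointed, which is the only
   reason for taking the output type in [pointedType]; its point plays no
   other role. *)
HB.instance Definition _ (n : nat) (O : Type) := gen_eqMixin (dtree n O).
HB.instance Definition _ (n : nat) (O : Type) := gen_choiceMixin (dtree n O).
HB.instance Definition _ (n : nat) (O : pointedType) :=
  isPointed.Build (dtree n O) (Leaf point).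
HB.instance Definition _ (n : nat) (O : pointedType) :=
  @isMeasurable.Build default_measure_display (dtree n O)
    discrete_measurable discrete_measurable0
    discrete_measurableC discrete_measurableU.

Definition randalg (R : realType) (n : nat) (O : pointedType) :=
  probability (dtree n O) R.

Definition computes (R : realType) (n : nat) (O : pointedType)
    (f : n.-tuple bool -> option O) (eps : R) (A : randalg R n O) : Prop :=
  forall x, x \in Dom f ->
    ((1 - eps)%:E <= A [set t | f x = Some (output t x)])%E.

(* This may be [+oo], since the trees in the support of [A] may be arbitrarily
   deep. *)
Definition expected_queries (R : realType) (n : nat) (O : pointedType)
    (A : randalg R n O) (x : n.-tuple bool) : \bar R :=
  'E_A[fun t => (nqueries t x)%:R]%E.

Definition worst_expected_queries (R : realType) (n : nat) (O : pointedType)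
    (f : n.-tuple bool -> option O) (A : randalg R n O) : \bar R :=
  (\big[maxe/-oo]_(x in Dom f) expected_queries A x)%E.

(* The minimum over algorithms is written as an infimum, so that the quantity
   is defined without first showing that it is attained. *)
Definition Rbar_err (R : realType) (n : nat) (O : pointedType)
    (f : n.-tuple bool -> option O) (eps : R) : \bar R :=
  ereal_inf [set worst_expected_queries f A | A in computes f eps].

Definition distribution_over (R : realType) (n : nat)
    (D : {pred n.-tuple bool}) (mu : n.-tuple bool -> R) : Prop :=
  [/\ forall x, 0 <= mu x,
      forall x, x \notin D -> mu x = 0
    & \sum_x mu x = 1].

(* Main.v *)
(** Pruning repeated queries makes every expected cost at most [n] without
    increasing it, so it suffices to treat algorithms of finite cost, whose cost
    vectors form a convex set because algorithms can be mixed. Every such vector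
    has a coordinate at least the minimax value [r]. The coordinates are merged
    into a single weighted average one at a time: two of them that cover a convex
    set by the half-planes [r <= x] and [r <= y] admit a convex combination that
    is at least [r] on the whole set. *)
Require Import Defs.
From mathcomp Require Import all_boot all_order all_algebra.
From mathcomp Require Import all_classical all_reals all_analysis.
From mathcomp Require Import measurable_realfun ring lra.

Import Order.TTheory GRing.Theory Num.Theory.

Local Open Scope ring_scope.

(** * Separation of convex sets, in the plane and then over the inputs *)

(** Points with [p.1 < r] bound [t] from below, points with [p.2 < r] from above. Convexity puts
    every lower bound under every upper one, so the supremum of the lower bounds works. *)
Lemma planar_separation (R : realType) (S : set (R * R)) (r : R) :
  (forall p q t, S p -> S q -> 0 <= t <= 1 ->
     S ((1 - t) * p.1 + t * q.1, (1 - t) * p.2 + t * q.2)) ->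
  (forall p, S p -> r <= p.1 \/ r <= p.2) ->
  exists2 t, 0 <= t <= 1 &
    forall p, S p -> r <= (1 - t) * p.1 + t * p.2.
Proof.
move=> convS coverS.
(* [bound p] is the weight at which the combination of [p.1] and [p.2] equals [r]; the element 0
   makes [E] nonempty and [sup E] nonnegative. *)
pose bound (p : R * R) := (r - p.1) / (p.2 - p.1).
pose E := [set t | t = 0 \/ exists2 p, S p /\ p.1 < r & t = bound p]%classic.
have gap p : S p -> p.1 < r -> r <= p.2.
  by move=> Sp pr; have [|//] := coverS _ Sp; rewrite leNgt pr.
have E0 : E 0 by left.
have E1 : ubound E 1.
  move=> _ [->|[p [Sp pr] ->]]; first exact: ler01.
  by have p2 := gap _ Sp pr; rewrite /bound ler_pdivrMr; lra.
have supE : has_sup E by split; [exists 0 | exists 1].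
have ge_supE t : E t -> t <= sup E by apply: ub_le_sup; case: supE.
have supE_le b : ubound E b -> sup E <= b by apply: ge_sup; exists 0.
have t0 := ge_supE _ E0; have t1 := supE_le _ E1.
exists (sup E) => [|p Sp]; first by rewrite t0.
have [p1r|rp1] := ltP p.1 r.
  have rp2 := gap _ Sp p1r.
  have : bound p <= sup E by apply: ge_supE; right; exists p.
  by rewrite /bound ler_pdivrMr; lra.
have [p2r|rp2] := ltP p.2 r; last by nra.
(* The right side is the weight at which the combination for [p], now decreasing in the weight,
   falls to [r]. *)
suff : sup E <= (p.1 - r) / (p.1 - p.2) by rewrite ler_pdivlMr; lra.
apply: supE_le => _ [->|[q [Sq q1r] ->]]; first by rewrite divr_ge0; lra.
have rq2 := gap _ Sq q1r.
rewrite /bound ler_pdivrMr; last by lra.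
rewrite mulrAC ler_pdivlMr; last by lra.
rewrite leNgt; apply/negP => lt_pq.
(* Otherwise the segment from [q] to [p] meets the quadrant [x < r, y < r]. *)
pose d := q.2 - q.1 + (p.1 - p.2).
have d0 : 0 < d by rewrite /d; lra.
(* At [s] the segment crosses the diagonal, so both coordinates agree there; [lt_pq] puts them below
   [r]. *)
pose s := (q.2 - q.1) / d.
have sd : s * d = q.2 - q.1 by rewrite /s divfK// gt_eqF.
have s01 : 0 <= s <= 1.
  by rewrite /s divr_ge0 ?ler_pdivrMr// /d; lra.
have below c e : (d - (q.2 - q.1)) * c + (q.2 - q.1) * e < d * r ->
    (1 - s) * c + s * e < r.
  move=> h; rewrite -(ltr_pM2l d0); apply: le_lt_trans h.
  by rewrite -sd le_eqVlt; apply/orP; left; apply/eqP; ring.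
have /= := coverS _ (convS _ _ _ Sq Sp s01).
by case; rewrite leNgt => /negP; apply; apply: below; rewrite /d; nra.
Qed.

Lemma dirac_distribution_over (R : realType) (n : nat)
    (D : {pred n.-tuple bool}) (i : n.-tuple bool) :
  i \in D -> distribution_over D (fun x => (x == i)%:R : R).
Proof.
move=> Di; split=> [x|x Dx|]; first exact: ler0n.
- by case: eqVneq Dx => // ->; rewrite Di.
- by rewrite (bigD1 i)//= eqxx big1 ?addr0// => j /negbTE ->.
Qed.

Lemma convex_minimax (R : realType) (n : nat) (D : {pred n.-tuple bool})
    (S : set (n.-tuple bool -> R)) (r : R) :
  (exists x, x \in D) ->
  (forall u v t, S u -> S v -> 0 <= t <= 1 ->
     S (fun x => (1 - t) * u x + t * v x)) ->
  (forall v, S v -> exists2 x, x \in D & r <= v x) ->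
  exists2 mu, distribution_over D mu &
    forall v, S v -> r <= \sum_x mu x * v x.
Proof.
move=> [x0 Dx0] convS coverS.
have dirac_dist i := @dirac_distribution_over R n D i.
have dirac_sum i (v : n.-tuple bool -> R) : \sum_x (x == i)%:R * v x = v i.
  rewrite (bigD1 i)//= eqxx mul1r big1 ?addr0// => j /negbTE ->.
  by rewrite mul0r.
(* Invariant: each vector of [S] reaches [r] in its [a]-average or at a coordinate in [s]. Initially
   [s] lists all of [D], so any Dirac mass in [D] serves as [a]. *)
suff merge s a : {subset s <= D} -> distribution_over D a ->
    (forall v, S v -> r <= \sum_x a x * v x \/ has (fun i => r <= v i) s) ->
    exists2 mu, distribution_over D mu &
      forall v, S v -> r <= \sum_x mu x * v x.
  apply: (merge (enum D) _ _ (dirac_dist _ Dx0)) => [x|v Sv].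
    by rewrite mem_enum.
  right; have [x Dx rx] := coverS _ Sv.
  by apply/hasP; exists x; rewrite ?mem_enum.
elim: s a => [|i s IHs] a sD da cover.
  by exists a => // v /cover[].
have Di : i \in D by apply: sD; rewrite mem_head.
(* [Q] keeps only vectors that stay below [r] on the tail [s]; the others satisfy the invariant for
   any weights. *)
pose Q := [set p | exists2 v, S v /\ ~~ has (fun i => r <= v i) s
                 & p = (\sum_x a x * v x, v i)]%classic.
have [_ _ t [u [Su us] ->] [v [Sv vs] ->] t01|_ [v [Sv vs] ->]|t t01 tQ] :=
    @planar_separation R Q r.
- exists (fun x => (1 - t) * u x + t * v x).
    split; first exact: convS.
    (* Staying below [r] at a coordinate survives convex combinations, so [Q] is convex. *)
    apply/hasPn => j js; move/hasPn/(_ j js): us; move/hasPn/(_ j js): vs.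
    rewrite -!ltNge; case/andP: t01 => t0 t1 vr ur.
  by have [uv|vu] := leP (u j) (v j); nra.
  congr pair => /=; rewrite !mulr_sumr -big_split/=.
  by apply: eq_bigr => x _; ring.
- have := cover _ Sv; rewrite /= (negbTE vs) orbF.
  by case; [left | right].
- apply: (IHs (fun x => (1 - t) * a x + t * (x == i)%:R)) => [x xs||v Sv].
  + by apply: sD; rewrite inE xs orbT.
  + have [d0 dD d1] := dirac_dist _ Di.
    case: da => a0 aD a1; split=> [x|x xD|].
    * by move: t01 => /andP[? ?]; rewrite addr_ge0// mulr_ge0// subr_ge0.
    * by rewrite aD// dD// !mulr0 addr0.
    * by rewrite big_split/= -!mulr_sumr a1 d1; ring.
  + have [hv|hv] := boolP (has _ s); [by right|left].
    rewrite (eq_bigr (fun x =>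
      (1 - t) * (a x * v x) + t * ((x == i)%:R * v x))); last first.
      by move=> x _; ring.
    rewrite big_split/= -!mulr_sumr dirac_sum.
    exact: (tQ (_, _)) (ex_intro2 _ _ v (conj Sv hv) erefl).
Qed.

(** * Mixtures of probability measures *)

Lemma probability_mixture d (T : measurableType d) (R : realType)
    (A B : probability T R) (t : R) : 0 <= t <= 1 ->
  exists C : probability T R,
    (forall U, C U = (1 - t)%:E * A U + t%:E * B U)%E /\
    (forall g : T -> \bar R,
      measurable_fun [set: T] g -> (forall x, 0 <= g x)%E ->
      \int[C]_x g x = (1 - t)%:E * \int[A]_x g x + t%:E * \int[B]_x g x)%E.
Proof.
move=> /andP[t0]; rewrite -subr_ge0 => t1.
pose m : {measure set T -> \bar R} :=
  measure_add (mscale (NngNum t1) A) (mscale (NngNum t0) B).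
have mE U : (m U = (1 - t)%:E * A U + t%:E * B U)%E by exact: measure_addE.
have mT : m setT = 1%E.
  by rewrite mE !probability_setT !mule1 -EFinD subrK.
have nE U : mnormalize m A U = m U.
  rewrite /mnormalize mT onee_eq0 /=.
  by rewrite invr1 mule1.
(* Normalization only packages [m], of mass 1 by [mT], as a probability; [A] is the fallback for
   mass 0 or [+oo], which does not arise. *)
exists (mnormalize m A); split=> [U|g mg g0]; first by rewrite -mE; exact: nE.
rewrite (eq_measure_integral m); last by move=> U _ _; exact: nE.
by rewrite ge0_integral_measure_add// !ge0_integral_mscale.
Qed.

(** * Pruning repeated queries *)

(* [k] records the bits already read along the branch. *)
Fixpoint prune (n : nat) (O : Type) (k : 'I_n -> option bool) (t : dtree n O) :
    dtree n O :=
  match t with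
  | Leaf o => Leaf o
  | Query i t0 t1 =>
      match k i with
      | Some b => if b then prune n O k t1 else prune n O k t0
      | None => Query i (prune n O [eta k with i |-> Some false] t0)
                        (prune n O [eta k with i |-> Some true] t1)
      end
  end.
Arguments prune {n O} k t.

Section Prune.
Context {n : nat} {O : Type} (x : n.-tuple bool).
Implicit Types (t : dtree n O) (k : 'I_n -> option bool).

Let agrees k := forall i b, k i = Some b -> tnth x i = b.

Let agrees_read k i : agrees k -> agrees [eta k with i |-> Some (tnth x i)].
Proof. by move=> kx j b /=; case: eqP => [-> [<-]|_ /kx]. Qed.

(** A dropped query would get the recorded answer on every input agreeing with [k]. *)
Lemma output_prune k t : agrees k -> output (prune k t) x = output t x.
Proof.
elim: t k => //= i t0 IH0 t1 IH1 k kx.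
case ki : (k i) => [b|/=].
  by rewrite (kx _ _ ki); case: b {ki}; [exact: IH1 | exact: IH0].
by have := agrees_read k i kx; case: (tnth x i) => ?; [exact: IH1 | exact: IH0].
Qed.

Lemma nqueries_prune k t : agrees k ->
  (nqueries (prune k t) x <= nqueries t x)%N.
Proof.
elim: t k => //= i t0 IH0 t1 IH1 k kx.
case ki : (k i) => [b|/=].
  by rewrite (kx _ _ ki) leqW//; case: b {ki}; [exact: IH1 | exact: IH0].
rewrite ltnS.
by have := agrees_read k i kx; case: (tnth x i) => ?; [exact: IH1 | exact: IH0].
Qed.

(** Each surviving query reads a bit unset in [k] and sets it for both subtrees, so it uses up one
    unset bit. *)
Lemma nqueries_prune_le_unread k t :
  (nqueries (prune k t) x <= #|[pred i | k i == None]|)%N.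
Proof.
elim: t k => //= i t0 IH0 t1 IH1 k.
case ki : (k i) => [[]|/=]; [exact: IH1 | exact: IH0 |].
have unread b : #|[pred j | k j == None]| =
    #|[pred j | [eta k with i |-> Some b] j == None]|.+1.
  rewrite (cardD1 i) inE ki eqxx add1n; congr _.+1.
  by apply: eq_card => j; rewrite !inE /=; case: eqP.
case: (tnth x i); first by rewrite (unread true) ltnS; exact: IH1.
by rewrite (unread false) ltnS; exact: IH0.
Qed.

End Prune.

(** * Mixing and pruning randomized algorithms *)

Section Randalg.
Set Implicit Arguments.
Unset Strict Implicit.
Context {R : realType} {n : nat} {O : pointedType}.
Implicit Types (A B : randalg R n O) (f : n.-tuple bool -> option O).

Lemma measurable_fun_dtree d (T : measurableType d) (g : dtree n O -> T) :
  measurable_fun [set: dtree n O] g.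
Proof. by move=> _ Y mY. Qed.

(** Success is a lower bound on a quantity linear in the measure, so a mixture inherits it. *)
Lemma computes_mixture f (eps : R) A B (t : R) :
  computes f eps A -> computes f eps B -> 0 <= t <= 1 ->
  exists2 C, computes f eps C &
    forall x, (expected_queries C x =
      (1 - t)%:E * expected_queries A x + t%:E * expected_queries B x)%E.
Proof.
move=> cA cB t01; have [C [CE intC]] := probability_mixture _ _ _ A B _ t01.
exists C => [x Dx|x].
  rewrite CE; case/andP: t01 => t0 t1.
  have -> : ((1 - eps)%:E =
      (1 - t)%:E * (1 - eps)%:E + t%:E * (1 - eps)%:E)%E.
    by rewrite -!EFinM -EFinD; congr _%:E; ring.
  apply: leeD; apply: lee_wpmul2l; rewrite ?lee_fin ?subr_ge0//.
  - exact: cA.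
  - exact: cB.
by rewrite /expected_queries unlock intC// => s; rewrite lee_fin.
Qed.

(** The image of [A] under pruning from the empty record has the same outputs; the bounds 0 and [n]
    make its costs real numbers. *)
Lemma computes_prune f (eps : R) A : computes f eps A ->
  exists2 B, computes f eps B & forall x,
    [/\ (expected_queries B x <= expected_queries A x)%E,
        (0 <= expected_queries B x)%E & (expected_queries B x <= n%:R%:E)%E].
Proof.
move=> cA; pose p : dtree n O -> dtree n O := prune (fun=> None).
pose pX : {mfun dtree n O >-> dtree n O} :=
  mfun_Sub (mem_set (measurable_fun_dtree p)).
have EB x : (expected_queries (distribution A pX) x =
    \int[A]_t (nqueries (p t) x)%:R%:E)%E.
  by rewrite /expected_queries unlock ge0_integral_distribution.
exists (distribution A pX) => [x Dx|x].
  have := cA x Dx; congr (_ <= A _)%E.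
  by apply/seteqP; split=> t /=; rewrite /p output_prune.
rewrite EB; split.
- rewrite /expected_queries unlock; apply: ge0_le_integral => // s _.
  by rewrite lee_fin ler_nat nqueries_prune.
- by apply: integral_ge0 => s _; rewrite lee_fin.
- apply: (@le_trans _ _ (\int[A]_t n%:R%:E)%E).
    apply: ge0_le_integral => // s _; rewrite lee_fin ler_nat.
    apply: leq_trans (nqueries_prune_le_unread _ _ _) _.
    by rewrite -[leqRHS]card_ord max_card.
  have -> : (\int[A]_t n%:R%:E = n%:R%:E * A setT)%E by exact: integral_cst.
  by rewrite (@probability_setT _ _ _ A) mule1.
Qed.

End Randalg.

Theorem theorem34 (R : realType) (n : nat) (O : pointedType)
    (f : n.-tuple bool -> option O) (eps : R)
    (Dom_nonempty : exists x : n.-tuple bool, x \in Dom f)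
    (eps_ge0 : 0 <= eps) :
  exists mu : n.-tuple bool -> R,
    distribution_over (Dom f) mu /\
    forall A : randalg R n O, computes f eps A ->
      (Rbar_err f eps <= \sum_x (mu x)%:E * expected_queries A x)%E.
Proof.
have Rbar_le A : computes f eps A ->
    (Rbar_err f eps <= worst_expected_queries f A)%E.
  by move=> cA; apply: ereal_inf_lbound; exists A.
pose S := [set v : n.-tuple bool -> R | exists2 A, computes f eps A &
  forall x, expected_queries A x = (v x)%:E]%classic.
have convS u v t : S u -> S v -> 0 <= t <= 1 ->
    S (fun x => (1 - t) * u x + t * v x).
  move=> [A cA Au] [B cB Bv] t01.
  have [C cC CE] := computes_mixture cA cB t01.
  by exists C => // x; rewrite CE Au Bv.
(* Each algorithm costs at least some vector of [S] at every input, so lower bounds on [S] extend to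
   all algorithms. *)
have pruned A : computes f eps A -> exists2 v, S v &
    forall x, ((v x)%:E <= expected_queries A x)%E.
  move=> cA; have [B cB BA] := computes_prune cA.
  have finB x : expected_queries B x \is a fin_num.
    by have [_ B0 Bn] := BA x; rewrite ge0_fin_numE// (le_lt_trans Bn) ?ltry.
  exists (fun x => fine (expected_queries B x)) => [|x].
    by exists B => // x; rewrite fineK.
  by rewrite fineK//; case: (BA x).
have coverS r v : (r%:E <= Rbar_err f eps)%E -> S v ->
    exists2 x, x \in Dom f & r <= v x.
  move=> rR [A cA Av].
  have [/exists_inP[x Dx rv]|/exists_inPn no] :=
    boolP [exists x in Dom f, r <= v x]; first by exists x.
  have := le_trans rR (Rbar_le _ cA).
  rewrite leNgt => /negP[]; apply: bigmax_lt => [|x Dx]; first exact: ltNyr.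
  by rewrite Av lte_fin ltNge no.
have lowerS r : (r%:E <= Rbar_err f eps)%E -> exists2 mu,
    distribution_over (Dom f) mu & forall A, computes f eps A ->
      (r%:E <= \sum_x (mu x)%:E * expected_queries A x)%E.
  move=> rR.
  have [mu dmu muS] := convex_minimax _ _ _ _ _ Dom_nonempty convS
    (fun v => coverS r v rR).
  exists mu => // A cA; have [v Sv vA] := pruned _ cA.
  apply: (@le_trans _ _ (\sum_x (mu x)%:E * (v x)%:E)%E).
    under eq_bigr do rewrite -EFinM.
    by rewrite sumEFin lee_fin; exact: muS.
  by apply: lee_sum => x _; apply: lee_wpmul2l => //; rewrite lee_fin; case: dmu.
case E : (Rbar_err f eps) => [r| |].
- by have [|mu dmu muA] := lowerS r; rewrite ?E//; exists mu.
(* Pruning gives any correct algorithm a finite worst cost, so [+oo] means that no algorithm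
   computes [f]; [lowerS 0] just supplies a distribution. *)
- have [|mu dmu _] := lowerS 0; first by rewrite E leey.
  exists mu; split=> // A cA; exfalso.
  have [v [B cB Bv] _] := pruned _ cA.
  have : (worst_expected_queries f B < +oo)%E.
    by apply: bigmax_lt => // x _; rewrite Bv ltry.
  by rewrite ltNge -E Rbar_le.
- have [x Dx] := Dom_nonempty.
  exists (fun y => (y == x)%:R).
  by split=> [|A cA]; [exact: dirac_distribution_over | exact: leNye].
Qed.
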